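(* Let $m\ge2$, let $p_1,\dots,p_m>0$ with $\sum_i p_i=1$ be linearly independent over $\mathbb{Q}$, and let $\beta\in\mathbb{R}$. For the $\beta$-linear divisor method with $N$ uniformly distributed on $\{1,\dots,N_0\}$, as $N_0\to\infty$, $$\operatorname{Var}\Delta_i\to\frac{1+(m-2)p_i^2}{12}$$ for every $i$, and, when $i\ne j$, $$\operatorname{Cov}(\Delta_i,\Delta_j)\to\frac{(m-2)p_ip_j-p_i-p_j}{12}.$$
   Context: There are $m$ parties; party $i$ has proportion $p_i>0$ of the votes. $N$ (the house size) seats are distributed, party $i$ gets $s_i=s_i(N)$ seats with $\sum_i s_i=N$, and the seat excess is $\Delta_i=s_i-Np_i$. For real $\alpha,x$, the $\alpha$-rounding $[x]_\alpha$ is an integer $n$ with $x-\alpha\le n\le x-\alpha+1$ (if $x-\alpha\in\mathbb{Z}$, both $x-\alpha$ and $x-\alpha+1$ are accepted values). The $\beta$-linear divisor method: $s_i=\max\{[p_i/D']_\beta,0\}$ where the real number $D'>0$ (and the choices of rounding in case of ties) are such that $\sum_i s_i=N$. The maximum with $0$ only matters if $\beta>1$ and $N$ is small; if $\beta\le 0$ the method is defined only for $N\ge m(\lfloor|\beta|\rfloor+1)$. Ties are resolved at random. Finitely many $N$ for which the method is undefined are irrelevant for the limit and may be ignored. *)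

(* Defs.v *)
From HB Require Import structures.
From mathcomp Require Import all_boot all_order all_algebra.
From mathcomp Require Import all_classical all_reals all_analysis.

Set Implicit Arguments.
Unset Strict Implicit.
Unset Printing Implicit Defensive.

Import Order.TTheory GRing.Theory Num.Theory.
Import numFieldNormedType.Exports.

Local Open Scope ring_scope.

Definition rat_lin_indep (R : realType) (m : nat) (p : 'I_m -> R) : Prop :=
  forall q : 'I_m -> rat,
    \sum_(i < m) ratr (q i) * p i = 0 -> forall i, q i = 0.

(* A relation, since both neighbouring integers are accepted values when
   x - alpha is an integer. *)
Definition alpha_rounding (R : realType) (alpha x : R) (n : int) : Prop :=
  x - alpha <= n%:~R <= x - alpha + 1.

(* The choices of rounding are made separately for each party. *)
Definition linear_divisor_outcome (R : realType) (m : nat) (p : 'I_m -> R)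
    (beta : R) (N : nat) (s : 'I_m -> nat) : Prop :=
  (\sum_(i < m) s i)%N = N /\
  exists D : R, 0 < D /\
    forall i, exists k : int,
      alpha_rounding beta (p i / D) k /\ (s i)%:Z = Num.max k 0.

Definition linear_divisor_defined (R : realType) (m : nat) (beta : R)
    (N : nat) : Prop :=
  beta <= 0 -> m%:Z * (Num.floor `|beta| + 1) <= N%:Z.

(* For the finitely many N at which the method is undefined, an arbitrary
   distribution of the N seats is allowed. *)
Definition linear_divisor_seats (R : realType) (m : nat) (p : 'I_m -> R)
    (beta : R) (N : nat) (s : 'I_m -> nat) : Prop :=
  (\sum_(i < m) s i)%N = N /\
  (linear_divisor_defined m beta N -> linear_divisor_outcome p beta N s).

Definition uniform_upto (R : realType) (d : measure_display)
    (T : measurableType d) (P : probability T R) (X : T -> nat)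
    (n : nat) : Prop :=
  forall k, (1 <= k <= n)%N -> P [set w | X w = k]%classic = (n%:R^-1)%:E.

Definition seat_excess (R : realType) (m : nat) (T : Type) (p : 'I_m -> R)
    (N : T -> nat) (s : 'I_m -> T -> nat) (i : 'I_m) (w : T) : R :=
  (s i w)%:R - (N w)%:R * p i.

(* Main.v *)
(* For large N the seats are s_i = floor(p_i x - beta + 1), where x (the inverse of
   the divisor) is the moment at which the last seat goes to some party j, so that
   p_j x - beta + 1 = n is an integer.  With U_l the fractional part of
   p_l x - beta + 1, summing over the parties gives
     Delta_i = (1 - beta)(1 - m p_i) - U_i + p_i sum_l U_l,
   and U_j = 0.  Along the jumps n = 1, 2, ... of party j, U_l is the rotation
   n p_l / p_j + const mod 1, so that linear independence makes the U_l (l <> j)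
   uncorrelated with mean 1/2 and variance 1/12; and a proportion p_j of the house
   sizes belongs to party j.  Averaging over j gives the limits.

   Uncorrelatedness of two rotations is proved without Fourier analysis: Kronecker's
   theorem provides shifts h that move the first angle by a small e and the second by
   much less than e, and the means are computed by integrating derivatives of
   polynomials along such shifts. *)
Require Import Defs.
From HB Require Import structures.
From mathcomp Require Import all_boot all_order all_algebra.
From mathcomp Require Import all_classical all_reals all_analysis.
From mathcomp Require Import measurable_realfun ring lra zify.

Import Order.TTheory GRing.Theory Num.Theory.
Import numFieldNormedType.Exports.

Local Open Scope classical_set_scope.
Local Open Scope ring_scope.

Set Implicit Arguments.
Unset Strict Implicit.

(** * Cesaro means *)

Definition has_mean {R : realType} (u : nat -> R) (l : R) : Prop :=
  (\sum_(k < n) u k) / n%:R @[n --> \oo] --> l.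

Section Means.
Context {R : realType}.
Implicit Types (u v : nat -> R) (l : R).

Lemma eq_has_mean u v l : u =1 v -> has_mean u l -> has_mean v l.
Proof. by move=> /funext ->. Qed.

Lemma has_meanD u v l l' :
  has_mean u l -> has_mean v l' -> has_mean (fun n => u n + v n) (l + l').
Proof.
move=> ul vl; rewrite /has_mean.
under eq_fun do rewrite big_split mulrDl.
exact: cvgD.
Qed.

Lemma has_meanZ (a : R) u l : has_mean u l -> has_mean (fun n => a * u n) (a * l).
Proof.
move=> ul; rewrite /has_mean.
under eq_fun do rewrite -mulr_sumr -mulrA.
exact: cvgMr.
Qed.

Lemma has_mean_cst (a : R) : has_mean (fun=> a) a.
Proof.
apply/(cvgrPdist_le (fun n : nat => (\sum_(k < n) a) / n%:R)) => e e0.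
near=> n; have n0 : (0 < n)%N by near: n; exact: nbhs_infty_gt.
by rewrite sumr_const card_ord -(mulr_natr a) mulfK ?pnatr_eq0 -?lt0n// subrr normr0 ltW.
Unshelve. all: end_near. Qed.

Lemma has_mean0 : has_mean (fun=> 0 : R) 0.
Proof. exact: has_mean_cst. Qed.

Lemma has_mean_sum (I : Type) (r : seq I) (u : I -> nat -> R) (l : I -> R) :
  (forall i, has_mean (u i) (l i)) ->
  has_mean (fun n => \sum_(i <- r) u i n) (\sum_(i <- r) l i).
Proof.
move=> ul; elim: r => [|i r IH].
  by rewrite big_nil; apply: eq_has_mean has_mean0 => n; rewrite big_nil.
rewrite big_cons.
by apply: (eq_has_mean _ (has_meanD (ul i) IH)) => n; rewrite big_cons.
Qed.

Lemma cvg_bounded_error (a : nat -> R) (l C : R) N1 :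
  (forall n, (N1 <= n)%N -> `|a n - n.+1%:R * l| <= C) ->
  a n / n.+1%:R @[n --> \oo] --> l.
Proof.
move=> aC; apply/(cvgrPdist_le (fun n => a n / n.+1%:R)) => e e0.
near=> n; have n0R : (0 : R) < n.+1%:R by rewrite ltr0n.
rewrite distrC -[l](mulKf (lt0r_neq0 n0R)) mulrC -mulrBr.
rewrite normrM gtr0_norm ?invr_gt0// ler_pdivrMl//.
apply: le_trans (aC n _) _; first by near: n; exact: nbhs_infty_ge.
rewrite -ler_pdivrMr//; apply: (@le_trans _ _ n%:R); last by rewrite ler_nat.
near: n; exact: nbhs_infty_ger.
Unshelve. all: end_near. Qed.

Lemma has_mean_bounded_error u (C l : R) :
  (forall n, `|\sum_(k < n) u k - n%:R * l| <= C) -> has_mean u l.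
Proof.
move=> uC; rewrite /has_mean -cvg_shiftS.
by apply: (@cvg_bounded_error _ _ C 0%N) => n _; exact: uC.
Qed.

(** The sum telescopes to [h] terms at either end, so it is at most [2 h B] in absolute value. *)
Lemma has_mean_shift u (B : R) (h : nat) :
  (forall n, `|u n| <= B) -> has_mean (fun n => u (n + h)%N - u n) 0.
Proof.
move=> uB; apply: (@has_mean_bounded_error _ (h%:R * B + h%:R * B)) => n.
have -> : \sum_(k < n) (u (k + h)%N - u k) =
          \sum_(k < h) u (n + k)%N - \sum_(k < h) u k.
  elim: n => [|n IH]; first by rewrite big_ord0 subrr.
  rewrite big_ord_recr IH /= -[u (n + h)%N - _ in LHS]opprB.
  have -> : \sum_(k < h) u (n.+1 + k)%N =
            \sum_(k < h) u (n + k)%N + u (n + h)%N - u n.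
    transitivity (\sum_(k < h.+1) u (n + k)%N - u n).
      rewrite big_ord_recl/= addn0 addrC addKr.
      by apply: eq_bigr => k _; rewrite /bump/= add1n addnS addSn.
    by rewrite big_ord_recr.
  by ring.
have bnd m : `|\sum_(k < h) u (m + k)%N| <= h%:R * B.
  apply: le_trans (ler_norm_sum _ _ _) _.
  rewrite -[X in X%:R * _]card_ord mulr_natl -sumr_const.
  by apply: ler_sum => k _; exact: uB.
rewrite mulr0 subr0; apply: le_trans (ler_normB _ _) _.
by apply: lerD => //; exact: bnd 0%N.
Qed.

(** The form in which equidistribution is proved: [v] collects telescoping terms, and [z] lets the
    error be large at some indices provided it is small on average. *)
Lemma has_mean_approx u l :
  (forall e, 0 < e -> exists v z, [/\ has_mean v 0, has_mean z 0 &
     forall n, `|u n - l - v n| <= e + z n]) -> has_mean u l.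
Proof.
move=> ul; apply/(cvgrPdist_le (fun n => (\sum_(k < n) u k) / n%:R)) => e e0.
have e3 : 0 < e / 3 by lra.
have [v [z [v0 z0 uvz]]] := ul _ e3.
have {v0} := (cvgrPdist_le _ _).1 v0 _ e3.
have {z0} := (cvgrPdist_le _ _).1 z0 _ e3.
move=> z0 v0; near=> n.
have n0 : (0 < n)%N by near: n; exact: nbhs_infty_gt.
have n0R : (0 : R) < n%:R by rewrite ltr0n.
have vn : `|0 - (\sum_(k < n) v k) / n%:R| <= e / 3 by near: n; exact: v0.
have zn : `|0 - (\sum_(k < n) z k) / n%:R| <= e / 3 by near: n; exact: z0.
have H : `|(\sum_(k < n) u k) / n%:R - l - (\sum_(k < n) v k) / n%:R| <=
          e / 3 + (\sum_(k < n) z k) / n%:R.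
  have -> : (\sum_(k < n) u k) / n%:R - l - (\sum_(k < n) v k) / n%:R =
            (\sum_(k < n) (u k - l - v k)) / n%:R.
    rewrite !big_split/= !sumrN sumr_const card_ord -(mulr_natr l).
    by field; rewrite lt0r_neq0.
  have -> : e / 3 + (\sum_(k < n) z k) / n%:R =
            (\sum_(k < n) (e / 3 + z k)) / n%:R.
    rewrite big_split/= sumr_const card_ord -(mulr_natr (e / 3)).
    by field; rewrite lt0r_neq0.
  rewrite normrM [`|n%:R^-1|]gtr0_norm ?invr_gt0// ler_pM2r ?invr_gt0//.
  apply: le_trans (ler_norm_sum _ _ _) _.
  by apply: ler_sum => k _; exact: uvz.
move: vn zn H; rewrite !ler_norml; lra.
Unshelve. all: end_near. Qed.

End Means.

(** * Rotations of the circle *)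

Definition frac {R : realType} (x : R) : R := x - (Num.floor x)%:~R.

Section Frac.
Context {R : realType}.
Implicit Types x y t : R.

Lemma frac_ge0 x : 0 <= frac x.
Proof. by rewrite subr_ge0 floor_le. Qed.

Lemma frac_lt1 x : frac x < 1.
Proof. by rewrite ltrBlDl -(intrD _ _ 1) floorD1_gt. Qed.

Lemma frac_eq x (k : int) : k%:~R <= x < k%:~R + 1 -> frac x = x - k%:~R.
Proof. by rewrite -(intrD _ _ 1) => /floor_def; rewrite /frac => ->. Qed.

Lemma fracDz x (k : int) : frac (x + k%:~R) = frac x.
Proof.
rewrite (@frac_eq _ (Num.floor x + k)) ?intrD; first by rewrite /frac; ring.
by move: (frac_ge0 x) (frac_lt1 x); rewrite /frac => *; apply/andP; split; lra.
Qed.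

Lemma frac_int (k : int) : frac (k%:~R : R) = 0.
Proof. by rewrite (@frac_eq _ k) ?subrr// lexx ltrDl ltr01. Qed.

(** The boolean is the carry: it records a passage through an integer. *)
Lemma fracD x y : exists w : bool,
  frac (x + y) = frac x + frac y - w%:R /\ w = (1 <= frac x + frac y).
Proof.
have := frac_ge0 x; have := frac_lt1 x; have := frac_ge0 y; have := frac_lt1 y.
move=> y1 y0 x1 x0; exists (1 <= frac x + frac y); split => //.
rewrite (@frac_eq _ (Num.floor x + Num.floor y + (1 <= frac x + frac y)%R)).
  by rewrite /frac !intrD; case: (_ <= _); rewrite /=; ring.
rewrite !intrD; have [] := leP 1 (frac x + frac y); move: x0 x1 y0 y1;
  by rewrite /frac /= => *; apply/andP; split; lra.
Qed.

End Frac.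

Section Rotation.
Context {R : realType}.
Variables (th a : R).
Let F n := frac (n%:R * th + a).

Lemma rotation_step h : exists w : nat -> bool, forall n,
  F (n + h) = F n + frac (h%:R * th) - (w n)%:R /\
  w n = (1 <= F n + frac (h%:R * th)).
Proof.
suff /choice[w wP] : forall n, exists w : bool,
  F (n + h) = F n + frac (h%:R * th) - w%:R /\
  w = (1 <= F n + frac (h%:R * th)) by exists w.
move=> n.
have -> : F (n + h) = frac (n%:R * th + a + h%:R * th).
  by rewrite /F natrD; congr frac; ring.
exact: fracD.
Qed.

(** Without a carry the increment is [frac (h th)]; with a carry it is 1 less. Taking [z] to be the
    opposite of the increment pays for these negative jumps, and it telescopes. *)
Lemma rotation_dist h :
  exists z, has_mean z 0 /\
    forall n, `|F (n + h) - F n| <= 2 * frac (h%:R * th) + z n.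
Proof.
exists (fun n => - (F (n + h) - F n)); split.
  rewrite -oppr0 -mulN1r; apply: (eq_has_mean (u := fun n => -1 * (F (n + h) - F n))).
    by move=> n; rewrite mulN1r.
  apply: has_meanZ; apply: (has_mean_shift (u := F) (B := 1)) => n.
  by rewrite ger0_norm ?frac_ge0// ltW ?frac_lt1.
have [w wP] := rotation_step h => n; have [-> wn] := wP n.
have := frac_ge0 (h%:R * th); have := frac_lt1 (h%:R * th).
by rewrite ler_norml; case: (w n) => /= e1 e0; apply/andP; split; lra.
Qed.

(* Integrating the derivative of [t^2 - t] along the rotation by a small angle
   [e]: for [Q := F^2 - F], which has no jump at the integers, the increment of
   [Q] is [2e (F - 1/2) + O(e^2)] except with frequency [e], where it is [O(e)]. *)
Lemma rotation_mean_mul (G : nat -> R) :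
  (forall n, `|G n| <= 1) ->
  (forall e : R, 0 < e -> exists h z, [/\ 0 < frac (h%:R * th) < e, has_mean z 0 &
     forall n, `|G (n + h)%N - G n| <= frac (h%:R * th) ^+ 2 + z n]) ->
  has_mean (fun n => (F n - 2^-1) * G n) 0.
Proof.
move=> G1 HG; apply: has_mean_approx => e e0.
(* Up to terms of mean 0 the error will be [4 d^2], which is at most [2 d e] once [d < e / 2]. *)
have e2 : 0 < e / 2 by lra.
have [h [z [/andP[]]]] := HG _ e2.
set d := frac _ => d0 de z0 Gz.
have [w wP] := rotation_step h; rewrite -/d in wP.
have F0 n : 0 <= F n by exact: frac_ge0.
have F1 n : F n < 1 by exact: frac_lt1.
pose Q n := F n ^+ 2 - F n.
have Q1 n : `|Q n| <= 1.
  by rewrite ler_norml /Q; have := F0 n; have := F1 n => *; apply/andP; split; nra.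
exists (fun n => (2 * d)^-1 * (Q (n + h)%N * G (n + h)%N - Q n * G n)).
(* The carry [w n] equals [d - (F (n + h) - F n)]: its frequency is [d] up to the telescoping term
   included here. *)
exists (fun n => (2 * d)^-1 * z n + (-1) * (F (n + h)%N - F n)); split.
- rewrite -(mulr0 (2 * d)^-1); apply: has_meanZ.
  apply: (has_mean_shift (u := fun n => Q n * G n) (B := 1)) => n.
  by rewrite normrM -(mulr1 1) ler_pM.
- have <- : (2 * d)^-1 * 0 + -1 * 0 = 0 :> R by rewrite !mulr0 addr0.
  apply: has_meanD; apply: has_meanZ => //.
  apply: (has_mean_shift (u := F) (B := 1)) => n.
  by rewrite ger0_norm ?F0// ltW.
move=> n; have [FE wE] := wP n.
have : `|2 * d * ((F n - 2^-1) * G n) - (Q (n + h)%N * G (n + h)%N - Q n * G n)|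
   <= 2 * d * e + (z n - 2 * d * (F (n + h)%N - F n)).
  have Fn0 := F0 n; have Fn1 := F1 n; have := F0 (n + h)%N; have := F1 (n + h)%N.
  have := Gz n; have := G1 n; have := Q1 (n + h)%N.
  rewrite -/(Q n).
  move=> Qn' Gn Gn' f1 f0.
  have -> : 2 * d * ((F n - 2^-1) * G n) - (Q (n + h)%N * G (n + h)%N - Q n * G n)
    = (2 * d * (F n - 2^-1) - (Q (n + h)%N - Q n)) * G n
      - Q (n + h)%N * (G (n + h)%N - G n) by ring.
  apply: le_trans (ler_normB _ _) _; rewrite !normrM.
  have A : `|Q (n + h)%N| * `|G (n + h)%N - G n| <= d ^+ 2 + z n.
    by apply: le_trans Gn'; rewrite -[leRHS]mul1r ler_wpM2r.
  have B : `|2 * d * (F n - 2^-1) - (Q (n + h)%N - Q n)| * `|G n| <=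
            d ^+ 2 + 2 * d * (w n)%:R.
    apply: (@le_trans _ _ (`|2 * d * (F n - 2^-1) - (Q (n + h)%N - Q n)|)).
      by rewrite -[leRHS]mulr1 ler_wpM2l.
    rewrite ler_norml /Q FE; move: wE f0 f1; rewrite FE.
    by case: (w n) => /= /esym; [|move/negbT; rewrite -ltNge] => wE f0 f1;
      apply/andP; split; nra.
  rewrite FE; nra.
have -> : (F n - 2^-1) * G n - 0
     - (2 * d)^-1 * (Q (n + h)%N * G (n + h)%N - Q n * G n) =
    (2 * d)^-1 * (2 * d * ((F n - 2^-1) * G n)
                  - (Q (n + h)%N * G (n + h)%N - Q n * G n)).
  by field; rewrite lt0r_neq0.
have d20 : 0 < (2 * d)^-1 by rewrite invr_gt0 mulr_gt0.
rewrite normrM gtr0_norm// => H.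
apply: le_trans (_ : _ <= (2 * d)^-1 *
    (2 * d * e + (z n - 2 * d * (F (n + h)%N - F n)))) _.
  by rewrite ler_pM2l.
by rewrite le_eqVlt; apply/orP; left; apply/eqP; field; rewrite lt0r_neq0.
Qed.

(* The same argument for [C := t^3 - 3/2 t^2 + t/2], which vanishes at 0 and 1. *)
Lemma rotation_mean_sqr :
  (forall e : R, 0 < e -> exists h : nat, 0 < frac (h%:R * th) < e) ->
  has_mean (fun n => (F n - 2^-1) ^+ 2) 12^-1.
Proof.
move=> H; apply: has_mean_approx => e e0.
have e3 : 0 < e / 3 by lra.
have [h /andP[]] := H _ e3.
set d := frac _ => d0 de.
have d1 : d < 1 by exact: frac_lt1.
have [w wP] := rotation_step h; rewrite -/d in wP.
have F0 n : 0 <= F n by exact: frac_ge0.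
have F1 n : F n < 1 by exact: frac_lt1.
pose C n := F n ^+ 3 - 3 / 2 * F n ^+ 2 + F n / 2.
have C1 n : `|C n| <= 1.
  rewrite ler_norml /C; have := F0 n; have := F1 n => f1 f0.
  have -> : F n ^+ 3 - 3 / 2 * F n ^+ 2 + F n / 2 =
    F n * (1 - F n) * (2^-1 - F n) by field.
  have A : 0 <= F n * (1 - F n) <= 1 by apply/andP; split; nra.
  by case/andP: A => A0 A1; apply/andP; split; nra.
(* The derivative of [C] is [3 ((t - 1/2)^2 - 1/12)], whence the factor. The second sequence again
   replaces the carry by [d], turning the bound [d + 2 w n] into [3 d]. *)
exists (fun n => (3 * d)^-1 * (C (n + h)%N - C n)).
exists (fun n => (-2) * (F (n + h)%N - F n)); split.
- rewrite -(mulr0 (3 * d)^-1); apply: has_meanZ.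
  exact: (has_mean_shift (u := C) (B := 1)).
- rewrite -(mulr0 (-2)).
  apply: has_meanZ => //; apply: (has_mean_shift (u := F) (B := 1)) => n.
  by rewrite ger0_norm ?F0// ltW.
move=> n; have [FE wE] := wP n.
have H1 : `|3 * d * ((F n - 2^-1) ^+ 2 - 12^-1) - (C (n + h)%N - C n)|
   <= 3 * d * (d + 2 * (w n)%:R).
  have Fn0 := F0 n; have Fn1 := F1 n; have := F0 (n + h)%N; have := F1 (n + h)%N.
  rewrite /C; move: wE; rewrite FE.
  case: (w n) => /= /esym; [|move/negbT; rewrite -ltNge] => wE f1 f0.
    (* At a carry [F n] lies within [d] of 1 and [F (n + h)] within [d] of 0, so [C] is at most [d]
       in absolute value at both. *)
    have Cbound (t : R) : 0 <= t <= 1 ->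
        `|t ^+ 3 - 3 / 2 * t ^+ 2 + t / 2| <= t * (1 - t).
      case/andP=> t0 t1.
      have -> : t ^+ 3 - 3 / 2 * t ^+ 2 + t / 2 = t * (1 - t) * (2^-1 - t) by field.
      rewrite normrM ger0_norm ?mulr_ge0 ?subr_ge0// -[leRHS]mulr1 ler_wpM2l//.
        by rewrite mulr_ge0 ?subr_ge0.
      by rewrite ler_norml; apply/andP; split; lra.
    have := Cbound (F n); have := Cbound (F n + d - 1).
    rewrite f0 (ltW f1) Fn0 (ltW Fn1) => /(_ isT) + /(_ isT).
    set x := _ + (_ + _) / 2; set y := _ + F n / 2.
    have Ed : (F n + d - 1) * (1 - (F n + d - 1)) <= d by nra.
    have Fd : F n * (1 - F n) <= d by nra.
    move=> /le_trans/(_ Ed) + /le_trans/(_ Fd).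
    have q1 : (F n - 2^-1) ^+ 2 - 12^-1 <= 1 by nra.
    have q0 : -1 <= (F n - 2^-1) ^+ 2 - 12^-1 by nra.
    rewrite !ler_norml => /andP[A1 A2] /andP[B1 B2].
    by apply/andP; split; nra.
  rewrite subr0.
  set lhs := (X in `|X| <= _).
  have -> : lhs = 3 * d * (- (d * (F n + d / 3 - 2^-1))) by rewrite /lhs; field.
  rewrite normrM gtr0_norm ?mulr_gt0// ler_pM2l ?mulr_gt0//.
  by rewrite ler_norml; apply/andP; split; nra.
have -> : (F n - 2^-1) ^+ 2 - 12^-1 - (3 * d)^-1 * (C (n + h)%N - C n) =
    (3 * d)^-1 * (3 * d * ((F n - 2^-1) ^+ 2 - 12^-1) - (C (n + h)%N - C n)).
  by field; rewrite lt0r_neq0.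
have d20 : 0 < (3 * d)^-1 by rewrite invr_gt0 mulr_gt0.
rewrite normrM gtr0_norm//.
apply: le_trans (_ : _ <= (3 * d)^-1 * (3 * d * (d + 2 * (w n)%:R))) _.
  by rewrite ler_pM2l.
rewrite mulKf ?lt0r_neq0 ?mulr_gt0// FE; lra.
Qed.

End Rotation.

(** * Kronecker's theorem *)

Section Kronecker.
Context {R : realType}.
Implicit Types th ph e : R.

(** Pigeonhole: the unit square is cut into [Q^2] cells of side [1 / Q < e], and two of [Q^2 + 1]
    multiples of [(th, ph)] fall into the same cell. *)
Lemma dirichlet th ph e : 0 < e -> exists (n : nat) (u v : int),
  [/\ (0 < n)%N, `|n%:R * th - u%:~R| < e & `|n%:R * ph - v%:~R| < e].
Proof.
move=> e0; pose q := (Num.trunc e^-1); pose Q := q.+1%:R : R.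
have Q0 : 0 < Q by rewrite ltr0n.
have Qe : 1 < e * Q.
  have : e^-1 < Q by exact: truncnS_gt.
  by move=> H; rewrite -(mulfV (lt0r_neq0 e0)) ltr_pM2l.
pose cell (x : R) : 'I_q.+1 := inord (Num.trunc (Q * frac x)).
have cellP x y : cell x = cell y -> `|frac x - frac y| < e.
  have itv z : (cell z)%:R <= Q * frac z < (cell z)%:R + 1.
    have z0 : 0 <= Q * frac z by rewrite mulr_ge0 ?frac_ge0 ?ltW.
    have zQ : Q * frac z < Q by rewrite -[ltRHS]mulr1 ltr_pM2l// frac_lt1.
    rewrite /cell inordK; first by have := truncn_itv z0; rewrite -natr1.
    by rewrite truncn_lt_nat.
  move=> xy; have := itv x; have := itv y; rewrite xy.
  move=> /andP[y0 y1] /andP[x0 x1]; rewrite -(ltr_pM2l Q0) mulrC.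
  rewrite -[X in _ * X](gtr0_norm Q0) -normrM ltr_norml.
  by apply/andP; split; lra.
pose f (n : 'I_(q.+1 * q.+1).+1) := (cell (n%:R * th), cell (n%:R * ph)).
have /injectivePn[n [m nm fnm]] : ~~ injectiveb f.
  apply/injectiveP => /leq_card; rewrite card_prod !card_ord.
  by rewrite ltnn.
wlog ltnm : n m nm fnm / (n < m)%N.
  move=> W; have [nm'|mn'|/val_inj E] := ltngtP n m; first exact: (W n m).
    by apply: (W m n) => //; rewrite eq_sym.
  by rewrite E eqxx in nm.
case: fnm => /esym/cellP c1 /esym/cellP c2.
exists (m - n)%N; exists (Num.floor (m%:R * th) - Num.floor (n%:R * th)).
exists (Num.floor (m%:R * ph) - Num.floor (n%:R * ph)).
rewrite subn_gt0 natrB ?(ltnW ltnm)//; split => //; rewrite intrB.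
  by move: c1; rewrite /frac; congr (`|_| < _); ring.
by move: c2; rewrite /frac; congr (`|_| < _); ring.
Qed.

(** Dirichlet gives a multiple close to an integer. If it lies below it by [d], then
    [k = floor (1 / d)] copies make the angle [1 - k d], which is less than [d] and nonzero by
    irrationality. *)
Lemma rotation_small_angle th e :
  (forall a b : int, a%:~R * th = b%:~R -> a = 0) -> 0 < e ->
  exists h : nat, 0 < frac (h%:R * th) < e.
Proof.
wlog e1 : e / e <= 1.
  move=> W irr e0; have [e1|/ltW e1] := leP e 1; first exact: W.
  have [h /andP[h0 h1]] := W 1 (lexx _) irr ltr01.
  by exists h; rewrite h0 (lt_le_trans h1).
move=> irr e0; have [n [u [v [n0 nu _]]]] := dirichlet th th e0.
have nz : n%:R * th - u%:~R != 0.
  apply/eqP => /eqP; rewrite subr_eq0 => /eqP /(irr n u) [E].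
  by rewrite E in n0.
have [pos|] := ltP 0 (n%:R * th - u%:~R).
  exists n; rewrite (@frac_eq _ _ u) ?pos ?(le_lt_trans (ler_norm _) nu)//.
  by move: nu; rewrite gtr0_norm// => nu; apply/andP; split; lra.
rewrite le_eqVlt (negbTE nz)/= => neg.
set d := u%:~R - n%:R * th.
have d0 : 0 < d by rewrite /d; lra.
have de : d < e by rewrite -(gtr0_norm d0) /d distrC.
pose k := Num.trunc d^-1.
have /truncn_itv/andP[k1 k2] : 0 <= d^-1 by rewrite invr_ge0 ltW.
have kd1 : k%:R * d <= 1 by rewrite -ler_pdivlMr// mul1r.
have kd2 : 1 < k%:R * d + d.
  by rewrite -[ltLHS](mulVf (lt0r_neq0 d0)) -[X in _ + X]mul1r -mulrDl natr1 ltr_pM2r.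
have kE : (k * n)%:R * th = - (k%:R * d) + (k%:Z * u)%:~R.
  by rewrite natrM intrM /d; ring.
exists (k * n)%N; rewrite kE fracDz.
have kd3 : k%:R * d != 1.
  apply/eqP => E; rewrite E in kE.
  have /(irr (Posz (k * n)) (k%:Z * u - 1)) [/eqP] : (k * n)%:R * th = (k%:Z * u - 1)%:~R.
    by rewrite kE intrB; ring.
  rewrite muln_eq0 => /orP[/eqP k0|/eqP n0']; last by rewrite n0' in n0.
  by move: E; rewrite k0 mul0r => /eqP; rewrite eq_sym oner_eq0.
have kd4 : k%:R * d < 1 by rewrite lt_neqAle kd3.
by rewrite (@frac_eq _ _ (-1)) ?mulrN1z; [|]; apply/andP; split; lra.
Qed.

Let shift_ge0 (h : int) (L : nat) : (0 < L)%N -> 0 <= h + `|h|%N%:Z * L%:Z.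
Proof. by move/(leq_pmulr `|h|%N); rewrite -PoszM; lia. Qed.

Let tri e (x y z : R) :
  `|x| < e / 6 -> `|y| < e / 3 -> `|z| < e / 6 -> `|- x - y + z| < e.
Proof.
rewrite !ltr_norml => /andP[? ?] /andP[? ?] /andP[? ?].
by apply/andP; split; lra.
Qed.

(* If [v] is a short vector of [Z (th, ph) + Z^2] and [g] an integer vector almost
   parallel to it, then [v] and [v' = g - k v] are short and independent, so their
   integer combinations are dense up to the length of [v] and [v']. *)
Lemma kronecker th ph :
  (forall a b c : int, a%:~R * th + b%:~R * ph = c%:~R -> a = 0 /\ b = 0) ->
  forall e al be : R, 0 < e -> exists (h : nat) (u v : int),
    `|h%:R * th - u%:~R - al| < e /\ `|h%:R * ph - v%:~R - be| < e.
Proof.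
move=> indep e al be e0.
have e6 : 0 < e / 6 by lra.
have [n [u [v [n0 nu nv]]]] := dirichlet th ph e6.
set d1 := _ - _ in nu; set d2 := _ - _ in nv.
have d10 : d1 != 0.
  apply/eqP => /eqP; rewrite subr_eq0 => /eqP E.
  have [|[]] := indep n 0 u; first by rewrite mul0r addr0.
  by move=> nE; rewrite nE in n0.
(* This is the integer vector [g = (a, b)]: the multiple of [v = (d1, d2)] with first coordinate [a]
   has second coordinate within [e / 6] of [b]. *)
have [a [b [_ [a0 ab _]]]] := dirichlet (d2 / d1) 0 e6.
(* A zero determinant would be an integer relation between [th], [ph] and 1 in which [ph] has the
   nonzero coefficient [n a]. *)
have det0 : a%:R * d2 - b%:~R * d1 != 0.
  apply/eqP => E; have [|_ /eqP] := indep (- (n%:Z * b)) (n%:Z * a%:Z) (a%:Z * v - b * u).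
    apply: subr0_eq; rewrite -E /d1 /d2 !(intrB, intrM, intrD, intrN); ring.
  by rewrite mulf_eq0 => /orP[/eqP[]|/eqP[]] E'; [move: n0|move: a0]; rewrite E'.
pose k := Num.floor (a%:R / d1).
pose w1 := a%:R - k%:~R * d1; pose w2 := b%:~R - k%:~R * d2.
have w1E : w1 = d1 * frac (a%:R / d1) by rewrite /w1 /frac -/k; field.
have w2E : w2 = - (a%:R * (d2 / d1) - b%:~R) + d2 * frac (a%:R / d1).
  by rewrite /w2 /frac -/k; field.
have shrink (x t : R) : `|x| < e / 6 -> 0 <= t < 1 -> `|x * t| < e / 6.
  move=> xe /andP[t0 t1]; rewrite normrM (ger0_norm t0).
  by apply: le_lt_trans xe; rewrite ler_piMr// ltW.
have fr (t : R) : 0 <= frac t < 1 by rewrite frac_ge0 frac_lt1.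
have w1e : `|w1| < e / 6 by rewrite w1E shrink.
have w2e : `|w2| < e / 3.
  have := shrink _ _ nv (fr (a%:R / d1)); move: ab.
  by rewrite w2E !ltr_norml => /andP[A B] /andP[C D]; apply/andP; split; lra.
have wdet : d2 * w1 - d1 * w2 = a%:R * d2 - b%:~R * d1 by rewrite /w1 /w2; ring.
(* Cramer's rule: [x], [y] are the coordinates of the target in the basis [(d1, d2)], [(w1, w2)].
   Rounding them down costs less than one basis vector each. *)
pose x := (be * w1 - al * w2) / (a%:R * d2 - b%:~R * d1).
pose y := (al * d2 - be * d1) / (a%:R * d2 - b%:~R * d1).
have xy1 : x * d1 + y * w1 = al.
  by rewrite /x /y -wdet; field; rewrite wdet.
have xy2 : x * d2 + y * w2 = be.
  by rewrite /x /y -wdet; field; rewrite wdet.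
pose i := Num.floor x; pose j := Num.floor y.
pose h := (n%:Z * (i - j * k)).
have E1 : h%:~R * th - (u * (i - j * k) - j * a)%:~R - al =
    - (d1 * frac x) - (w1 * frac y).
  by rewrite -xy1 /h /frac -/i -/j /w1 /d1 !(intrB, intrM, intrD); ring.
have E2 : h%:~R * ph - (v * (i - j * k) - j * b)%:~R - be =
    - (d2 * frac x) - (w2 * frac y).
  by rewrite -xy2 /h /frac -/i -/j /w2 /d2 !(intrB, intrM, intrD); ring.
(* The multiplier [h] may be negative. Adding [H L], with [L] chosen so that [H L (th, ph)] is
   within [e / 6] of an integer vector, makes it nonnegative. *)
pose H := `|h|%N.
have eH : 0 < e / 6 / (H%:R + 1) by rewrite divr_gt0// ltr_wpDl.
have [L [u' [v' [L0 Lu Lv]]]] := dirichlet th ph eH.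
pose h' := h + H%:Z * L%:Z.
have h'0 : 0 <= h' by exact: shift_ge0.
exists `|h'|%N; exists (u * (i - j * k) - j * a + H%:Z * u').
exists (v * (i - j * k) - j * b + H%:Z * v').
have -> : `|h'|%N%:R = h%:~R + H%:R * L%:R :> R.
  by rewrite pmulrn gez0_abs// intrD intrM.
have bnd t s : `|L%:R * t - s%:~R| < e / 6 / (H%:R + 1) ->
    `|H%:R * (L%:R * t - s%:~R)| < e / 6.
  rewrite ltr_pdivlMr ?ltr_wpDl// => /(le_lt_trans _); apply.
  by rewrite normrM ger0_norm// mulrC ler_wpM2l// lerDl.
have {}Lu := bnd _ _ Lu; have {}Lv := bnd _ _ Lv.
have := shrink _ _ nu (fr x); have := shrink _ _ nv (fr x).
have := shrink _ _ w1e (fr y).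
have w2y : `|w2 * frac y| < e / 3.
  have /andP[t0 t1] := fr y; rewrite normrM (ger0_norm t0).
  by apply: le_lt_trans w2e; rewrite ler_piMr// ltW.
move=> A1 A2 A3; split.
  have -> : (h%:~R + H%:R * L%:R) * th - (u * (i - j * k) - j * a + H%:Z * u')%:~R - al
    = - (d1 * frac x) - (w1 * frac y) + H%:R * (L%:R * th - u'%:~R).
    by rewrite -E1 intrD (intrM _ H%:Z); ring.
  by apply: tri => //; apply: lt_trans A1 _; lra.
have -> : (h%:~R + H%:R * L%:R) * ph - (v * (i - j * k) - j * b + H%:Z * v')%:~R - be
    = - (d2 * frac x) - (w2 * frac y) + H%:R * (L%:R * ph - v'%:~R).
  by rewrite -E2 intrD (intrM _ H%:Z); ring.
exact: tri.
Qed.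

End Kronecker.

Section Equidistribution.
Context {R : realType}.
Implicit Types th ph a b e : R.

(** Kronecker is aimed at [(e / 2, e^2 / 64)] with precision [e^2 / 64]. The first angle is then at
    least [e / 4] and the second at most [e^2 / 32 = (e / 4)^2 / 2]. The 2 in the bound cancels the
    one in [rotation_dist]. *)
Lemma rotation_small_angles th ph e :
  (forall a b c : int, a%:~R * th + b%:~R * ph = c%:~R -> a = 0 /\ b = 0) ->
  0 < e -> exists h : nat,
    0 < frac (h%:R * th) < e /\ frac (h%:R * ph) <= frac (h%:R * th) ^+ 2 / 2.
Proof.
wlog e1 : e / e <= 1.
  move=> W irr e0; have [e1|/ltW e1] := leP e 1; first exact: W.
  have [h [/andP[h0 h1] h2]] := W 1 (lexx _) irr ltr01.
  by exists h; rewrite h0 (lt_le_trans h1).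
move=> indep e0.
have e64 : 0 < e ^+ 2 / 64 by rewrite divr_gt0// exprn_gt0.
have [h [u [v [hu hv]]]] := kronecker indep (e / 2) (e ^+ 2 / 64) e64.
have ee : e ^+ 2 <= e by rewrite expr2 ler_piMr// ltW.
move: hu hv; rewrite !ltr_norml => /andP[hu1 hu2] /andP[hv1 hv2].
exists h; rewrite (@frac_eq _ _ u); last by apply/andP; split; lra.
rewrite (@frac_eq _ _ v); last by apply/andP; split; lra.
split; first by apply/andP; split; lra.
have : e / 4 <= h%:R * th - u%:~R by lra.
have e40 : 0 <= e / 4 by lra.
move=> H; have : (e / 4) ^+ 2 <= (h%:R * th - u%:~R) ^+ 2.
  by rewrite lerXn2r ?nnegrE// (le_trans e40).
rewrite expr_div_n; lra.
Qed.

Lemma mean_frac th a :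
  (forall a b : int, a%:~R * th = b%:~R -> a = 0) ->
  has_mean (fun n => frac (n%:R * th + a) - 2^-1) 0.
Proof.
move=> irr.
have := @rotation_mean_mul R th a (fun=> 1).
rewrite normr1 => /(_ (fun=> lexx _)) W.
apply: (eq_has_mean _ (W _)) => [n|e e0]; first by rewrite mulr1.
have [h he] := rotation_small_angle irr e0.
exists h, (fun=> 0); split => // [|n]; first exact: has_mean0.
by rewrite subrr normr0 addr0 exprn_ge0// frac_ge0.
Qed.

Lemma mean_frac_sqr th a :
  (forall a b : int, a%:~R * th = b%:~R -> a = 0) ->
  has_mean (fun n => (frac (n%:R * th + a) - 2^-1) ^+ 2) 12^-1.
Proof.
by move=> irr; apply: rotation_mean_sqr => e e0; exact: rotation_small_angle.
Qed.

Lemma mean_frac_mul th ph a b :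
  (forall a b c : int, a%:~R * th + b%:~R * ph = c%:~R -> a = 0 /\ b = 0) ->
  has_mean (fun n => (frac (n%:R * th + a) - 2^-1) * (frac (n%:R * ph + b) - 2^-1)) 0.
Proof.
move=> indep.
apply: (@rotation_mean_mul R th a (fun n => frac (n%:R * ph + b) - 2^-1)).
  move=> n; have := frac_ge0 (n%:R * ph + b); have := frac_lt1 (n%:R * ph + b).
  by move=> *; rewrite ler_norml; apply/andP; split; lra.
move=> e e0; have [h [he hp]] := rotation_small_angles indep e0.
have [z [z0 zP]] := rotation_dist ph b h.
exists h, z; split => // n.
have -> (x y : R) : x - 2^-1 - (y - 2^-1) = x - y by ring.
by apply: le_trans (zP n) _; lra.
Qed.

End Equidistribution.

(** * Roundings and seats *)

Section Roundings.
Context {R : realType} {m : nat}.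
Variables (p : 'I_m -> R) (beta : R).
Hypothesis p_gt0 : forall i, 0 < p i.
Hypothesis p_sum : \sum_(i < m) p i = 1.
Implicit Types (x : R) (s t : 'I_m -> int).

(** Here [x] stands for the inverse of the divisor, and the values are integers without the maximum
    with 0. *)
Definition rounding x s := forall i, alpha_rounding beta (p i * x) (s i).

Lemma rounding_sum x s : rounding x s ->
  x - m%:R * beta <= (\sum_i s i)%:~R <= x - m%:R * beta + m%:R.
Proof.
move=> xs; rewrite rmorph_sum /=.
have E : \sum_(i < m) (p i * x - beta) = x - m%:R * beta.
  by rewrite sumrB -mulr_suml p_sum mul1r sumr_const card_ord mulr_natl.
apply/andP; split; rewrite -E; first by apply: ler_sum => i _; have /andP[] := xs i.
rewrite -[X in X%:R](card_ord m) -sumr_const -big_split/=.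
by apply: ler_sum => i _; have /andP[] := xs i.
Qed.

Lemma rounding_mono x y s t : rounding x s -> rounding y t -> x < y ->
  forall i, s i <= t i.
Proof.
move=> xs yt xy i; have /andP[_ A] := xs i; have /andP[B _] := yt i.
rewrite -ltzD1 -(ltr_int R) intrD; apply: le_lt_trans A _.
by have : p i * x < p i * y by [rewrite ltr_pM2l]; lra.
Qed.

Lemma eq_of_le_sum s t : (forall i, s i <= t i) -> \sum_i s i = \sum_i t i -> s =1 t.
Proof.
move=> st E i; apply/eqP; rewrite eq_sym -subr_eq0.
have /psumr_eq0P H : forall i, true -> 0 <= t i - s i by move=> k _; rewrite subr_ge0.
by rewrite H// sumrB E subrr.
Qed.

(** One party may still be at an integer point: that is its jump. *)
Definition no_tie x := forall i l,
  p i * x - beta \is a Num.int -> p l * x - beta \is a Num.int -> i = l.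

(** Two roundings at the same [x] can differ only at a tied party. There is at most one, so a
    difference there would change the sum. *)
Lemma rounding_unique_no_tie x s t : no_tie x -> rounding x s -> rounding x t ->
  \sum_i s i = \sum_i t i -> s =1 t.
Proof.
move=> nt xs xt E.
have tie a b i : rounding x a -> rounding x b -> (a i < b i)%R ->
    p i * x - beta \is a Num.int.
  move=> xa xb; rewrite -lezD1 -(ler_int R) intrD => ab.
  have /andP[A _] := xa i; have /andP[_ B] := xb i.
  have -> : p i * x - beta = (a i)%:~R by lra.
  exact: intr_int.
apply: eq_of_le_sum => // i; rewrite leNgt; apply/negP => ts.
have ti := tie _ _ _ xt xs ts.
suff : \sum_i t i < \sum_i s i by rewrite E ltxx.
rewrite (bigD1 i)//= [ltRHS](bigD1 i)//= ltr_leD//; apply: ler_sum => l li.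
rewrite leNgt; apply/negP => sl; have tl := tie _ _ _ xs xt sl.
by rewrite (nt _ _ ti tl) eqxx in li.
Qed.

Lemma rounding_unique X x y s t :
  (forall z, X < z -> no_tie z) -> X < x -> X < y ->
  rounding x s -> rounding y t -> \sum_i s i = \sum_i t i -> s =1 t.
Proof.
move=> nt Xx Xy xs yt E; have [xy|yx|xy] := ltgtP x y.
- exact: eq_of_le_sum (rounding_mono xs yt xy) E.
- by move=> i; rewrite (eq_of_le_sum (rounding_mono yt xs yx) (esym E)).
- by rewrite -xy in yt; exact: rounding_unique_no_tie (nt _ Xx) xs yt E.
Qed.

(** Lower [x] until some party is about to lose a seat: [f i] is the point where party [i] gains its
    last seat, and [y] is the largest of these. *)
Lemma last_jump x s (i0 : 'I_m) : rounding x s -> exists j, exists y,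
  rounding y s /\ (s j)%:~R = p j * y - beta + 1.
Proof.
move=> xs; pose f i := ((s i)%:~R - 1 + beta) / p i.
case: (@Order.TotalTheory.arg_maxP _ _ _ i0 xpredT f) => // j _ jmax.
have fE i : (s i)%:~R = p i * f i - beta + 1.
  by rewrite /f mulrC divfK ?lt0r_neq0//; ring.
have fx i : f i <= x.
  by rewrite ler_pdivrMr// mulrC; have /andP[] := xs i; lra.
exists j, (f j); split => // i; apply/andP; split.
  have /andP[+ _] := xs i; apply: le_trans.
  by rewrite lerD2r ler_pM2l.
by rewrite fE !lerD2r ler_pM2l//; exact: jmax.
Qed.

(** Only a tied party could take the value [p i * y - beta]; the one tied party is [j], which takes
    the upper value. *)
Lemma rounding_floor y s j : no_tie y -> rounding y s ->
  (s j)%:~R = p j * y - beta + 1 ->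
  forall i, (s i)%:~R = p i * y - beta + 1 - frac (p i * y - beta + 1).
Proof.
move=> nt ys sj i; have /andP[A B] := ys i.
suff lt : p i * y - beta < (s i)%:~R.
  by rewrite (@frac_eq _ _ (s i)); [ring|apply/andP; split; lra].
rewrite lt_neqAle A andbT; apply/eqP => E.
have ij : i = j.
  apply: nt; first by rewrite E intr_int.
  have -> : p j * y - beta = (s j)%:~R - 1 by rewrite sj; ring.
  by rewrite rpredB ?intr_int ?rpred1.
move: E; rewrite ij sj => E.
by have : (1 : R) <= 0 by [lra]; rewrite ler10.
Qed.

Lemma rounding_before_jump y s j : rounding y s ->
  (s j)%:~R = p j * y - beta + 1 ->
  rounding y (fun i => s i - (i == j)%:R).
Proof.
move=> ys sj i; have /andP[A B] := ys i; rewrite /alpha_rounding intrB.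
have [->|ij] := eqVneq i j; last by rewrite subr0 A B.
by rewrite sj (_ : (true%:R : int)%:~R = 1 :> R)//; apply/andP; split; lra.
Qed.

End Roundings.

Lemma int_lin_indep {R : realType} m (p : 'I_m -> R) (z : 'I_m -> int) :
  rat_lin_indep p -> \sum_i (z i)%:~R * p i = 0 -> forall i, z i = 0.
Proof.
move=> indep E i; apply/eqP; rewrite -(intr_eq0 rat); apply/eqP.
apply: (indep (fun i => (z i)%:~R)); rewrite -[RHS]E.
by apply: eq_bigr => k _; rewrite ratr_int.
Qed.

(** Two different points at which the same two parties tie would give an integer relation between
    their proportions, so each pair ties at most once; [X] bounds these finitely many points. *)
Lemma ties_bounded {R : realType} m (p : 'I_m -> R) beta :
  (forall i, 0 < p i) -> rat_lin_indep p -> exists X, forall x, X < x -> no_tie p beta x.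
Proof.
move=> p_gt0 indep.
have /choice[X XP] : forall il : 'I_m * 'I_m, exists X, forall x, X < x ->
    p il.1 * x - beta \is a Num.int -> p il.2 * x - beta \is a Num.int ->
    il.1 = il.2.
  move=> -[i l]/=; have [->|il] := eqVneq i l; first by exists 0.
  have [[x0 [/intrP[a ai] /intrP[b bl]]]|nx] :=
    pselect (exists x, p i * x - beta \is a Num.int /\ p l * x - beta \is a Num.int).
    exists x0 => x x0x /intrP[a' ai'] /intrP[b' bl']; exfalso.
    have : forall k, (if k == i then b' - b else if k == l then a - a' else 0) = 0.
      apply: (int_lin_indep indep).
      rewrite (bigD1 i)//= (bigD1 l)/=; last by rewrite eq_sym.
      rewrite eqxx [l == i]eq_sym (negbTE il) eqxx big1 ?addr0; last first.
        by move=> k /andP[/negbTE -> /negbTE ->]; rewrite mul0r.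
      by rewrite !intrB -ai -bl -ai' -bl'; ring.
    move=> /(_ i); rewrite eqxx => /eqP; rewrite subr_eq0 => /eqP bb.
    move: bl' x0x; rewrite bb -bl => /addIr/mulfI ->; first by rewrite ltxx.
    by rewrite lt0r_neq0.
  by exists 0 => x _ H1 H2; exfalso; apply: nx; exists x.
exists (\sum_il `|X il|) => x Xx i l Hi Hl.
apply: (XP (i, l) x) => //; apply: le_lt_trans Xx.
apply: le_trans (ler_norm _) _.
by rewrite (bigD1 (i, l))//= lerDl sumr_ge0.
Qed.

Lemma sum_Posz (I : finType) (s : I -> nat) :
  \sum_i (s i)%:Z = (\sum_i s i)%N%:Z.
Proof. by rewrite (big_morph Posz PoszD (erefl _)). Qed.

(** * The divisor method for large house sizes *)

Section Seats.
Context {R : realType} {m : nat}.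
Variables (p : 'I_m -> R) (beta : R).
Hypothesis p_gt0 : forall i, 0 < p i.
Hypothesis p_sum : \sum_(i < m) p i = 1.
Hypothesis p_indep : rat_lin_indep p.
Implicit Types (N : nat) (s t : 'I_m -> nat).

(** A large [N] forces a small divisor, hence [p i / D >= beta] for all [i]; the rounded values are
    then nonnegative and equal the seats. *)
Lemma seats_rounding : exists N1, forall N s, (N1 <= N)%N ->
  linear_divisor_seats p beta N s ->
  exists x, rounding p beta x (fun i => (s i)%:Z).
Proof.
(* The second term bounds [N - 1 / D], as each party has at most [p l / D + |beta| + 1] seats. What
   remains for [1 / D] exceeds every [|beta| / p i]. *)
pose C := \sum_i (`|beta| / p i) + m%:R * (`|beta| + 1).
pose N1 := maxn (absz (m%:Z * (Num.floor `|beta| + 1))) (Num.trunc C).+1.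
exists N1 => N s; rewrite geq_max => /andP[Nd NC] [sN /(_ _)[]].
  move=> _; apply: (le_trans (ler_norm _)).
  by rewrite -abszE lez_nat.
move=> _ [D [D0 kP]]; exists D^-1 => i.
have {}kP l : exists k, alpha_rounding beta (p l * D^-1) k /\ (s l)%:Z = Num.max k 0.
  exact: kP.
have CN : C < N%:R.
  by apply: lt_le_trans (truncnS_gt C) _; rewrite ler_nat.
have ND : N%:R <= D^-1 + m%:R * (`|beta| + 1).
  have -> : D^-1 + m%:R * (`|beta| + 1) = \sum_l (p l * D^-1 + (`|beta| + 1)).
    by rewrite big_split/= -mulr_suml p_sum mul1r sumr_const card_ord mulr_natl.
  rewrite -sN natr_sum; apply: ler_sum => l _.
  have [k [/andP[_ k2] sk]] := kP l.
  have -> : (s l)%:R = (Num.max k 0)%:~R :> R by rewrite -sk.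
  have := ler_norm (- beta); rewrite normrN => nb.
  have pD : 0 < p l * D^-1 by rewrite mulr_gt0// invr_gt0.
  have b0 := normr_ge0 beta.
  by have [k0|k0] := leP k 0; lra.
have bD : beta <= p i * D^-1.
  have : `|beta| / p i <= D^-1.
    apply: le_trans (_ : \sum_l (`|beta| / p l) <= _); last by rewrite /C in CN; lra.
    rewrite (bigD1 i)//= lerDl sumr_ge0// => l _.
    by rewrite divr_ge0// ltW.
  by rewrite ler_pdivrMr// mulrC; exact: le_trans (ler_norm _).
have [k [ki sk]] := kP i; rewrite sk.
suff /max_idPl -> : 0 <= k by [].
have /andP[k1 _] := ki.
by rewrite -(ler_int R); apply: le_trans k1; rewrite subr_ge0.
Qed.

(** By [rounding_sum], [N] is at most [y - m beta + m], so a large [N] puts [y] beyond all ties.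
    Every admissible [y] is covered, since the moment of the last jump may differ from [x]. *)
Lemma seats_no_tie : exists (X : R) N1,
  (forall x, X < x -> no_tie p beta x) /\
  forall N s, (N1 <= N)%N -> linear_divisor_seats p beta N s ->
  exists x, rounding p beta x (fun i => (s i)%:Z) /\
    forall y, rounding p beta y (fun i => (s i)%:Z) -> X < y.
Proof.
have [X XP] := ties_bounded beta p_gt0 p_indep.
have [N1 N1P] := seats_rounding.
exists X, (maxn N1 (Num.trunc (X - m%:R * beta + m%:R)).+1); split=> // N s.
rewrite geq_max => /andP[NN1 NX] Ns.
have [x xs] := N1P _ _ NN1 Ns; exists x; split => // y ys.
have /andP[_] := rounding_sum p_sum ys; rewrite sum_Posz (proj1 Ns) => H.
have : X - m%:R * beta + m%:R < N%:R.
  by apply: lt_le_trans (truncnS_gt _) _; rewrite ler_nat.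
by move: H; rewrite -pmulrn; lra.
Qed.

(** Makes the seats a function of the house size, whatever the random resolution of ties. *)
Lemma seats_unique : exists N1, forall N s t, (N1 <= N)%N ->
  linear_divisor_seats p beta N s -> linear_divisor_seats p beta N t -> s =1 t.
Proof.
have [X [N1 [nt H]]] := seats_no_tie.
exists N1 => N s t NN1 Ns Nt.
have [x [xs Xx]] := H _ _ NN1 Ns; have [y [yt Xy]] := H _ _ NN1 Nt.
have st := rounding_unique p_gt0 nt (Xx _ xs) (Xy _ yt) xs yt _.
move=> i; apply/eqP; rewrite -eqz_nat; apply/eqP; apply: st.
by rewrite !sum_Posz (proj1 Ns) (proj1 Nt).
Qed.

(** Solving the jump equation for [y = (s j + beta - 1) / p j] turns the fractional parts at [y]
    into rotations by [p l / p j] at time [s j]. *)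
Lemma excess_at_jump y s j (N := (\sum_i s i)%N) : no_tie p beta y ->
  rounding p beta y (fun i => (s i)%:Z) -> (s j)%:R = p j * y - beta + 1 ->
  forall i, (s i)%:R - N%:R * p i = (1 - beta) * (1 - m%:R * p i) +
    \sum_l (p i - (i == l)%:R) *
      frac ((s j)%:R * (p l / p j) + (p l * (beta - 1) / p j - beta + 1)).
Proof.
move=> nt ys sj i.
have pj : p j != 0 by rewrite lt0r_neq0.
pose u l := frac (p l * y - beta + 1).
have fE l : (s l)%:R = p l * y - beta + 1 - u l.
  exact: (rounding_floor (s := fun i => (s i)%:Z) nt ys sj l).
transitivity ((1 - beta) * (1 - m%:R * p i) + \sum_l (p i - (i == l)%:R) * u l).
  have -> : N%:R = y - m%:R * beta + m%:R - \sum_l u l.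
    rewrite natr_sum (eq_bigr _ (fun l _ => fE l)) sumrB; congr (_ - _).
    rewrite big_split/= sumrB -mulr_suml p_sum mul1r !sumr_const card_ord.
    by rewrite mulr_natl.
  have -> : \sum_l (p i - (i == l)%:R) * u l = p i * \sum_l u l - u i.
    rewrite (eq_bigr _ (fun l _ => mulrBl _ _ _)) sumrB mulr_sumr; congr (_ - _).
    rewrite (bigD1 i)//= eqxx mul1r big1 ?addr0// => l /negbTE.
    by rewrite eq_sym => ->; rewrite mul0r.
  by rewrite fE; ring.
congr (_ + _); apply: eq_bigr => l _; rewrite /u; congr (_ * frac _).
by rewrite sj; field.
Qed.

Lemma seats_step (S : nat -> 'I_m -> nat) :
  (0 < m)%N ->
  (forall N, (0 < N)%N -> linear_divisor_seats p beta N (S N)) ->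
  exists N1, forall N, (N1 <= N)%N -> exists j,
    (forall i, S N.+1 i = S N i + (i == j))%N /\
    forall i, (S N.+1 i)%:R - N.+1%:R * p i = (1 - beta) * (1 - m%:R * p i) +
    \sum_l (p i - (i == l)%:R) *
      frac ((S N.+1 j)%:R * (p l / p j) + (p l * (beta - 1) / p j - beta + 1)).
Proof.
move=> m0 SP; have [X [N1 [nt H]]] := seats_no_tie.
exists N1.+1 => N N1N.
have SN0 := SP N (leq_trans (ltn0Sn _) N1N); have SN1 := SP N.+1 (ltn0Sn _).
have [x0 [xs0 Xx0]] := H _ _ (ltnW N1N) SN0.
have [x1 [xs1 Xx1]] := H _ _ (leqW (ltnW N1N)) SN1.
have [j [y [ys sj]]] := last_jump p_gt0 (Ordinal m0) xs1.
have Xy := Xx1 _ ys.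
exists j; split; last first.
  by have := excess_at_jump (nt _ Xy) ys sj; rewrite (proj1 SN1).
have ys' := rounding_before_jump ys sj.
(* Just before party j gets its last seat, the same divisor yields a distribution of
   N seats, which is the only one. *)
have Ssum : \sum_i (S N i)%:Z = \sum_i ((S N.+1 i)%:Z - (i == j)%:R).
  rewrite sumrB !sum_Posz (proj1 SN0) (proj1 SN1) (bigD1 j)//= eqxx big1 ?addr0.
    by rewrite -addn1 PoszD addrK.
  by move=> k /negbTE ->.
have st := rounding_unique p_gt0 nt (Xx0 _ xs0) Xy xs0 ys' Ssum.
move=> i; apply/eqP; rewrite -eqz_nat PoszD -subr_eq; apply/eqP.
by rewrite -[(i == j)%:Z]natz -st.
Qed.

End Seats.

(** * Means of the seat excesses *)

Section MeanJump.
Context {R : realType}.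

(** House sizes are regrouped by the party that gets the last seat: up to a constant, the sum of [F]
    is the sum over [j] of [G j] up to [S N j], and [S N j / N] tends to [p j]. *)
Lemma mean_jump m (S : nat -> 'I_m -> nat) (p : 'I_m -> R) (F : nat -> R)
    (G : 'I_m -> nat -> R) (g : 'I_m -> R) (C : R) N1 :
  (forall i, 0 < p i) ->
  (forall N i, (N1 <= N)%N -> `|(S N i)%:R - N%:R * p i| <= C) ->
  (forall N, (N1 <= N)%N -> exists j,
     (forall i, S N.+1 i = S N i + (i == j))%N /\ F N.+1 = G j (S N.+1 j)) ->
  (forall j, has_mean (G j) (g j)) ->
  has_mean F (\sum_j p j * g j).
Proof.
move=> p_gt0 SC step Gg.
pose B N := \sum_j \sum_(k < (S N j).+1) G j k.
pose c := \sum_(k < N1.+1) F k - B N1.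
have FE N : (N1 <= N)%N -> \sum_(k < N.+1) F k = c + B N.
  elim: N => [|N IH]; first by rewrite leqn0 => /eqP E; rewrite /c E subrK.
  rewrite leq_eqVlt => /orP[/eqP E|N1N]; first by rewrite /c E subrK.
  rewrite big_ord_recr/= IH//; have [j [Sj ->]] := step N N1N.
  rewrite -addrA; congr (_ + _); rewrite /B (bigD1 j)//= [RHS](bigD1 j)//=.
  rewrite addrAC Sj eqxx addn1 [in RHS]big_ord_recr/=; congr (_ + _).
  by apply: eq_bigr => k /negbTE kj; rewrite Sj kj addn0.
suff H : (c + B n) / n.+1%:R @[n --> \oo] --> \sum_j p j * g j.
  rewrite /has_mean -cvg_shiftS; apply: cvg_trans H.
  apply: near_eq_cvg; near=> n; rewrite /= FE//.
  by near: n; exact: nbhs_infty_ge.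
under eq_fun do rewrite mulrDl.
have <- : 0 + \sum_j p j * g j = \sum_j p j * g j by rewrite add0r.
apply: cvgD.
  by apply: (@cvg_bounded_error _ _ _ `|c| 0%N) => n _; rewrite mulr0 subr0.
under eq_fun do rewrite mulr_suml.
apply: cvg_big => [|j _]; first exact: add_continuous.
have -> : (fun n => (\sum_(k < (S n j).+1) G j k) / n.+1%:R) =
    (fun n => (S n j).+1%:R / n.+1%:R * ((\sum_(k < (S n j).+1) G j k) / (S n j).+1%:R)).
  by apply/funext => n; rewrite [RHS]mulrC mulrA divfK ?pnatr_eq0.
apply: cvgM.
  apply: (@cvg_bounded_error _ _ _ (C + 1 + p j) N1) => n N1n.
  have := SC _ j N1n; rewrite -!natr1 !ler_norml => /andP[c1 c2].
  by have := p_gt0 j => pj; apply/andP; split; lra.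
apply: (cvg_comp (fun n => (S n j).+1) (fun n => (\sum_(k < n) G j k) / n%:R) _ (Gg j)).
apply/cvgnyPge => A; near=> n; apply: leqW; rewrite -(ler_nat R).
have : `|(S n j)%:R - n%:R * p j| <= C by apply: SC; near: n; exact: nbhs_infty_ge.
have : (A%:R + C) / p j <= n%:R by near: n; exact: nbhs_infty_ger.
by rewrite ler_pdivrMr// ler_norml => H /andP[c1 _]; lra.
Unshelve. all: end_near. Qed.

End MeanJump.

(** Evaluates the averages over parties that occur in the first and second moments. *)
Lemma sum_delta {R : realType} m (w : 'I_m -> R) (x y a b : R) (i k : 'I_m) :
  \sum_l w l * ((x + a * (i == l)%:R) * (y + b * (k == l)%:R)) =
  x * y * \sum_l w l + x * b * w k + y * a * w i + a * b * (i == k)%:R * w i.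
Proof.
have D (f : 'I_m -> R) c : \sum_l f l * (c == l)%:R = f c.
  rewrite (bigD1 c)//= eqxx mulr1 big1 ?addr0// => l /negbTE.
  by rewrite eq_sym => ->; rewrite mulr0.
have -> : a * b * (i == k)%:R * w i = \sum_l (a * b * w l * (k == l)%:R) * (i == l)%:R.
  by rewrite D [k == i]eq_sym; ring.
rewrite -(D (fun l => x * b * w l) k) -(D (fun l => y * a * w l) i) mulr_sumr.
rewrite -!big_split/=; apply: eq_bigr => l _; ring.
Qed.

Section Limits.
Context {R : realType} {m : nat}.
Variables (p : 'I_m -> R) (beta : R).
Hypothesis p_gt0 : forall i, 0 < p i.
Hypothesis p_sum : \sum_(i < m) p i = 1.
Hypothesis p_indep : rat_lin_indep p.

Let u (j l : 'I_m) (n : nat) : R :=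
  frac (n%:R * (p l / p j) + (p l * (beta - 1) / p j - beta + 1)).
(** The fractional part centered at its mean over the jumps of [j]: this is 1/2, except for [l = j],
    where the part vanishes. *)
Let b j l n := u j l n - (l != j)%:R / 2.

Lemma ratio_irr j l : l != j ->
  forall x y : int, x%:~R * (p l / p j) = y%:~R -> x = 0.
Proof.
move=> lj x y E.
have : forall k, (if k == l then x else if k == j then - y else 0) = 0.
  apply: (int_lin_indep p_indep).
  rewrite (bigD1 l)//= (bigD1 j)/=; last by rewrite eq_sym.
  rewrite eqxx [j == l]eq_sym (negbTE lj) eqxx big1 ?addr0; last first.
    by move=> k /andP[/negbTE -> /negbTE ->]; rewrite mul0r.
  by rewrite intrN -E; field; rewrite lt0r_neq0.
by move=> /(_ l); rewrite eqxx.
Qed.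

(** Multiplication by [p j] gives an integer relation between three distinct proportions. *)
Lemma ratio_indep j l l' : l != j -> l' != j -> l != l' ->
  forall x y z : int, x%:~R * (p l / p j) + y%:~R * (p l' / p j) = z%:~R ->
  x = 0 /\ y = 0.
Proof.
move=> lj l'j ll' x y z E.
have H : forall k, (if k == l then x else if k == l' then y
    else if k == j then - z else 0) = 0.
  apply: (int_lin_indep p_indep).
  rewrite (bigD1 l)//= (bigD1 l')/=; last by rewrite eq_sym.
  rewrite (bigD1 j)/=; last by rewrite ![j == _]eq_sym lj.
  rewrite !eqxx [l' == l]eq_sym (negbTE ll') ![j == _]eq_sym (negbTE lj) (negbTE l'j).
  rewrite big1 ?addr0; last first.
    by move=> k /andP[/andP[/negbTE -> /negbTE ->] /negbTE ->]; rewrite mul0r.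
  by rewrite intrN -E; field; rewrite lt0r_neq0.
have := H l; have := H l'.
by rewrite !eqxx [l' == l]eq_sym (negbTE ll').
Qed.

Lemma offset_diag j n : b j j n = 0.
Proof.
rewrite /b /u eqxx mul0r subr0.
have -> : n%:R * (p j / p j) + (p j * (beta - 1) / p j - beta + 1) = n%:Z%:~R :> R.
  by rewrite -pmulrn; field; rewrite lt0r_neq0.
exact: frac_int.
Qed.

Lemma mean_offset j l : has_mean (b j l) 0.
Proof.
have [->|lj] := eqVneq l j.
  by apply: eq_has_mean has_mean0 => n; rewrite offset_diag.
apply: (eq_has_mean _ (mean_frac _ (ratio_irr lj))) => n.
by rewrite /b /u lj mul1r.
Qed.

Lemma mean_offset_mul j l l' :
  has_mean (fun n => b j l n * b j l' n) ((l == l')%:R * (l != j)%:R / 12).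
Proof.
have [->|lj] := eqVneq l j.
  rewrite mulr0 mul0r; apply: eq_has_mean has_mean0 => n.
  by rewrite offset_diag mul0r.
have [->|l'j] := eqVneq l' j.
  rewrite (negbTE lj) !mul0r; apply: eq_has_mean has_mean0 => n.
  by rewrite offset_diag mulr0.
have [->|ll'] := eqVneq l l'.
  rewrite !mul1r; apply: (eq_has_mean _ (mean_frac_sqr _ (ratio_irr l'j))) => n.
  by rewrite /b /u l'j mul1r expr2.
rewrite !mul0r.
apply: (eq_has_mean _ (mean_frac_mul _ _ (ratio_indep lj l'j ll'))) => n.
by rewrite /b /u lj l'j !mul1r.
Qed.

(** The mean excess of party [i] over the jumps of any other party; over its own jumps it is larger
    by 1/2. *)
Let d i := (1 - beta) * (1 - m%:R * p i) + ((m%:R - 1) * p i - 1) / 2.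
Let G i j n := d i + (i == j)%:R / 2 + \sum_l (p i - (i == l)%:R) * b j l n.

Lemma excess_centered i j n : (1 - beta) * (1 - m%:R * p i) +
    \sum_l (p i - (i == l)%:R) * u j l n = G i j n.
Proof.
rewrite /G /b [in RHS](eq_bigr _ (fun l _ => mulrBr _ _ _)) sumrB.
suff -> : \sum_l (p i - (i == l)%:R) * ((l != j)%:R / 2) =
   ((m%:R - 1) * p i - 1) / 2 + (i == j)%:R / 2 by rewrite /d; ring.
transitivity (\sum_l 2^-1 * ((p i + (-1) * (i == l)%:R) * (1 + (-1) * (j == l)%:R))).
  by apply: eq_bigr => l _; rewrite [l == j]eq_sym; case: (j == l) => /=; field.
have /= -> := sum_delta (fun=> 2^-1) (p i) 1 (-1) (-1) i j.
by rewrite sumr_const card_ord -mulr_natr; field.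
Qed.

Lemma mean_excess_jump i j : has_mean (G i j) (d i + (i == j)%:R / 2).
Proof.
rewrite -[X in has_mean _ X]addr0; apply: has_meanD; first exact: has_mean_cst.
have E : \sum_l (p i - (i == l)%:R) * 0 = 0 by rewrite big1// => l _; rewrite mulr0.
rewrite -[X in has_mean _ X]E.
apply: (has_mean_sum (u := fun l n => (p i - (i == l)%:R) * b j l n)) => l.
by apply: has_meanZ; exact: mean_offset.
Qed.

(** Product of the means plus covariance: the offsets being uncorrelated, only the terms [l = l'] of
    the double sum survive, each with variance 1/12 unless [l = j]. *)
Lemma mean_excess_mul_jump i k j : has_mean (fun n => G i j n * G k j n)
  ((d i + (i == j)%:R / 2) * (d k + (k == j)%:R / 2) +
   \sum_l (p i - (i == l)%:R) * (p k - (k == l)%:R) * (l != j)%:R / 12).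
Proof.
pose h i := d i + (i == j)%:R / 2.
pose a i (l : 'I_m) : R := p i - (i == l)%:R.
have E n : h i * h k + (h i * (G k j n - h k) + h k * (G i j n - h i) +
    \sum_l \sum_l' (a i l * a k l') * (b j l n * b j l' n)) = G i j n * G k j n.
  have -> : \sum_l \sum_l' (a i l * a k l') * (b j l n * b j l' n) =
     (G i j n - h i) * (G k j n - h k).
    rewrite /G /h ![_ + _ - _]addrC !addKr mulr_suml.
    apply: eq_bigr => l _; rewrite mulr_sumr; apply: eq_bigr => l' _.
    by rewrite /a; ring.
  ring.
apply: (eq_has_mean E); apply: has_meanD; first exact: has_mean_cst.
have centered i' : has_mean (fun n => G i' j n - h i') 0.
  by have := has_meanD (@mean_excess_jump i' j) (@has_mean_cst R (- h i')); rewrite subrr.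
rewrite -[X in has_mean _ X]add0r; apply: has_meanD.
  have H0 : h i * 0 + h k * 0 = 0 by rewrite !mulr0 addr0.
  rewrite -[X in has_mean _ X]H0.
  exact: has_meanD (has_meanZ (centered k)) (has_meanZ (centered i)).
apply: (has_mean_sum (u := fun l n =>
  \sum_l' (a i l * a k l') * (b j l n * b j l' n))) => l.
have -> : a i l * a k l * (l != j)%:R / 12 =
    \sum_l' a i l * a k l' * ((l == l')%:R * (l != j)%:R / 12).
  rewrite (bigD1 l)//= eqxx big1 ?addr0; first by rewrite mul1r !mulrA.
  by move=> l'; rewrite eq_sym => /negbTE ->; rewrite !mul0r mulr0.
apply: (has_mean_sum (u := fun l' n => (a i l * a k l') * (b j l n * b j l' n))).
by move=> l'; apply: has_meanZ; exact: mean_offset_mul.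
Qed.

(** The Kronecker term joins variance and covariance in one formula: for [i = k] it cancels
    [- 2 p i] and adds the 1. *)
Lemma excess_means (S : nat -> 'I_m -> nat)
    (D := fun i N => (S N i)%:R - N%:R * p i) :
  (0 < m)%N ->
  (forall N, (0 < N)%N -> linear_divisor_seats p beta N (S N)) ->
  exists mu : 'I_m -> R, (forall i, has_mean (D i) (mu i)) /\
    forall i k, has_mean (fun N => D i N * D k N)
      (mu i * mu k + ((m%:R - 2) * p i * p k - p i - p k
                      + (i == k)%:R * (1 + 2 * p i)) / 12).
Proof.
move=> m0 SP; have [N1 step] := seats_step p_gt0 p_sum p_indep m0 SP.
pose c i := `|(1 - beta) * (1 - m%:R * p i)| + \sum_l `|p i - (i == l)%:R|.
have c_ge0 i : 0 <= c i by rewrite addr_ge0// sumr_ge0.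
have DC N i : (N1.+1 <= N)%N -> `|D i N| <= \sum_i c i.
  case: N => // N N1N; have [j [_ DE]] := step N N1N.
  apply: (@le_trans _ _ (c i)); last by rewrite (bigD1 i)//= lerDl sumr_ge0.
  rewrite /D DE; apply: le_trans (ler_normD _ _) _; rewrite lerD2l.
  apply: le_trans (ler_norm_sum _ _ _) _; apply: ler_sum => l _.
  by rewrite normrM ler_piMr// ger0_norm ?frac_ge0// ltW ?frac_lt1.
have jump N : (N1.+1 <= N)%N -> exists j,
    (forall i, S N.+1 i = S N i + (i == j))%N /\
    forall i, D i N.+1 = G i j (S N.+1 j).
  move=> /ltnW/step[j [Sj DE]]; exists j; split => // i.
  by rewrite /D DE excess_centered.
exists (fun i => d i + p i / 2); split => [i|i k].
  have -> : d i + p i / 2 = \sum_j p j * (d i + (i == j)%:R / 2).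
    transitivity (\sum_j p j * ((d i + 2^-1 * (i == j)%:R) * (1 + 0 * (i == j)%:R))).
      by rewrite sum_delta p_sum; ring.
    by apply: eq_bigr => j _; ring.
  apply: (mean_jump p_gt0 DC _ (@mean_excess_jump i)) => N N1N.
  by have [j [Sj DE]] := jump N N1N; exists j.
set lim := (X in has_mean _ X).
have -> : lim = \sum_j p j * ((d i + (i == j)%:R / 2) * (d k + (k == j)%:R / 2) +
   \sum_l (p i - (i == l)%:R) * (p k - (k == l)%:R) * (l != j)%:R / 12).
  (* For each [j], the product of the means over its jumps plus the covariance along them, which is
     a sum over all [l] minus its term [l = j]. *)
  transitivity (\sum_j (p j * ((d i + 2^-1 * (i == j)%:R) * (d k + 2^-1 * (k == j)%:R))
    + 12^-1 * (p j * (m%:R * p i * p k - p i - p k + (i == k)%:R)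
       - p j * ((p i + (-1) * (i == j)%:R) * (p k + (-1) * (k == j)%:R))))).
    rewrite big_split/= sum_delta -mulr_sumr sumrB sum_delta -mulr_suml p_sum /lim.
    by field.
  apply: eq_bigr => j _; rewrite [RHS]mulrDr; congr (_ + _); first by ring.
  rewrite -mulrBr mulrCA; congr (_ * _).
  have -> : m%:R * p i * p k - p i - p k + (i == k)%:R =
      \sum_l 1 * ((p i + (-1) * (i == l)%:R) * (p k + (-1) * (k == l)%:R)).
    have /= -> := sum_delta (fun=> 1) (p i) (p k) (-1) (-1) i k.
    by rewrite sumr_const card_ord; ring.
  rewrite (bigD1 j)//= [RHS](bigD1 j)//= eqxx mulr0 mul0r add0r mul1r.
  rewrite [X in _ * X]addrAC subrr add0r.
  by rewrite mulr_sumr; apply: eq_bigr => l lj; rewrite lj mulr1 mul1r; field.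
apply: (mean_jump (F := fun N => D i N * D k N)
  (G := fun j n => G i j n * G k j n) p_gt0 DC _ (@mean_excess_mul_jump i k)) => N N1N.
by have [j [Sj DE]] := jump N N1N; exists j; rewrite !DE.
Qed.

End Limits.

(** * Expectation under a uniform house size *)

(** House sizes start at 1, whereas [has_mean] sums from 0. The correction [1 + harmonic n] is
    [(n + 2) / (n + 1)]. *)
Lemma has_mean_succ {R : realType} (u : nat -> R) (l : R) :
  has_mean u l -> has_mean (fun n => u n.+1) l.
Proof.
move=> ul; rewrite /has_mean -cvg_shiftS/=.
have -> : (fun n => (\sum_(k < n.+1) u k.+1) / n.+1%:R) =
  (fun n => (\sum_(k < n.+2) u k) / n.+2%:R * (1 + harmonic n) - u 0%N * harmonic n).
  apply/funext => n /=; rewrite [in RHS]big_ord_recl/=.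
  under [in RHS]eq_bigr do rewrite /bump/= add1n.
  have n1 : n.+1%:R != 0 :> R by rewrite pnatr_eq0.
  have n2 : n.+2%:R != 0 :> R by rewrite pnatr_eq0.
  have -> : 1 + n.+1%:R^-1 = n.+2%:R / n.+1%:R :> R.
    by rewrite -[n.+2%:R]natr1 mulrDl divff// mul1r.
  by rewrite mulrA divfK// mulrDl addrC addKr.
have {1}-> : l = l * (1 + 0) - u 0%N * 0 by rewrite addr0 mulr1 mulr0 subr0.
have h0 : @harmonic R @ \oo --> 0 by exact: cvg_harmonic.
apply: cvgB; last exact: cvgMr.
apply: cvgM; last by apply: cvgD => //; exact: cvg_cst.
by rewrite /has_mean -2!cvg_shiftS in ul.
Qed.

Section UniformHouse.
Context {R : realType} {d : measure_display} {T : measurableType d}.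
Variables (N : {mfun T >-> nat}) (f : T -> R) (B H : nat -> R) (N1 : nat).
Hypotheses (B_ge0 : forall k, 0 <= B k) (mf : measurable_fun setT f).
Hypothesis (fB : forall w, `|f w| <= B (N w)).
Hypothesis fH : forall w, (N1 <= N w)%N -> f w = H (N w).

Let A (k : nat) : set T := [set w | N w = k].

Let mA k : measurable (A k).
Proof. by apply: (@measurable_funPTI _ _ _ _ N [set k]). Qed.

(** The events [N = k] with [1 <= k <= n] carry all the mass, [1 / n] each. From [N1] on, [f] is the
    constant [H k] on such an event; below, only the bound [B] is available, which costs an error
    independent of [n]. *)
Lemma uniform_expectation (P : probability T R) n : (0 < n)%N ->
  uniform_upto P N n ->
  f \in Lfun P 1 /\ exists r, ('E_P[f] = r%:E)%E /\
    `|n%:R * r - \sum_(k < n) H k.+1| <= \sum_(k < N1) (B k + `|H k|).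
Proof.
move=> n0 unif.
pose F (k : 'I_n) := A k.+1.
have mF k : measurable (F k) by exact: mA.
have tF : trivIset setT F.
  by move=> i j _ _ [w [/= wi wj]]; apply/val_inj/succn_inj; rewrite -wi -wj.
have PF k : P (F k) = (n%:R^-1)%:E by rewrite unif//= ltn_ord.
pose U := \big[setU/set0]_(k < n) F k.
have mU : measurable U by exact: bigsetU_measurable.
have PU : P U = 1%E.
  rewrite /U measure_semi_additive_ord// (eq_bigr _ (fun k _ => PF k)).
  rewrite sumEFin sumr_const card_ord -(mulr_natl n%:R^-1) divff//.
  by rewrite pnatr_eq0 -lt0n.
have PV : P (~` U) = 0%E by rewrite probability_setC// PU subee.
have mfE D : measurable_fun D (EFin \o f : T -> \bar R).
  by apply: measurable_funTS; exact/measurable_EFinP.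
have intU : P.-integrable U (EFin \o f).
  apply: measurable_bounded_integrable => //.
  - by rewrite (le_lt_trans (probability_le1 _ _))// ltry.
  - exact: measurable_funTS.
  - exists (\sum_(k < n) B k.+1); split; first exact: num_real.
    move=> x Bx w; rewrite /U -bigcup_seq => -[k _ Aw] /=.
    apply: le_trans (ltW Bx); apply: le_trans (fB w) _; rewrite Aw.
    by rewrite (bigD1 k)//= lerDl sumr_ge0.
have intT : P.-integrable setT (EFin \o f).
  apply/(negligible_integrable (measurableC mU)) => //.
  by rewrite setTD setCK.
split; first exact/Lfun1_integrable.
have Ef : ('E_P[f] = \sum_(k < n) \int[P]_(x in F k) (f x)%:E)%E.
  rewrite unlock (negligible_integral (measurableC mU))// setTD setCK.
  by apply: integral_bigsetU_EFin => //; [exact: index_enum_uniq|exact: sub_trivIset tF].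
pose c k := if (k < N1)%N then B k + `|H k| else 0.
have Fint (k : 'I_n) : exists r, (\int[P]_(x in F k) (f x)%:E = r%:E)%E /\
    `|n%:R * r - H k.+1| <= c k.+1.
  have n0R : (0 : R) < n%:R by rewrite ltr0n.
  rewrite /c; case: ltnP => kN.
    have bnd : (`|\int[P]_(x in F k) (f x)%:E| <= (B k.+1 / n%:R)%:E)%E.
      apply: le_trans (le_abse_integral _ _ _) _ => //.
      rewrite EFinM -(PF k); apply: integral_le_bound => //; first by rewrite lee_fin.
      by apply: aeW => w /= Fw; rewrite lee_fin (le_trans (fB w))// Fw.
    have fin : (\int[P]_(x in F k) (f x)%:E)%E \is a fin_num.
      by rewrite fin_num_abs (le_lt_trans bnd)// ltry.
    exists (fine (\int[P]_(x in F k) (f x)%:E)); rewrite fineK//; split => //.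
    move: bnd; rewrite -(fineK fin) /= lee_fin ler_pdivlMr// => bnd.
    apply: le_trans (ler_normB _ _) _; rewrite lerD2r normrM ger0_norm ?ler0n//.
    by rewrite mulrC.
  exists (H k.+1 / n%:R); split.
    rewrite (eq_integral (cst (H k.+1)%:E)).
      transitivity ((H k.+1)%:E * P (F k))%E; last by rewrite PF -EFinM.
      exact: integral_cst.
    by move=> w; rewrite inE => Fw /=; rewrite fH Fw.
  by rewrite mulrCA divff ?lt0r_neq0// mulr1 subrr normr0.
have /choice[r rP] := Fint.
exists (\sum_k r k); split.
  by rewrite Ef -sumEFin; apply: eq_bigr => k _; case: (rP k).
rewrite mulr_sumr -sumrB; apply: le_trans (ler_norm_sum _ _ _) _.
apply: (@le_trans _ _ (\sum_(k < n) c k.+1)).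
  by apply: ler_sum => k _; case: (rP k).
have c_ge0 k : 0 <= c k by rewrite /c; case: ifP => // _; rewrite addr_ge0.
(* Both sides are compared with one longer sum, whose terms vanish from index [N1] on. *)
apply: (@le_trans _ _ (\sum_(k < n.+1 + N1) c k)).
  rewrite big_split_ord /= big_ord_recl -addrA addrCA lerDl.
  by rewrite addr_ge0// sumr_ge0.
rewrite addnC big_split_ord /= [X in _ + X]big1 ?addr0 => [|k _]; last first.
  by rewrite /c ltnNge leq_addr.
by apply: ler_sum => k _; rewrite /c ltn_ord.
Qed.

End UniformHouse.

Lemma uniform_expectation_cvg {R : realType} {d : measure_display}
    {T : measurableType d} (P : nat -> probability T R) (N : {mfun T >-> nat})
    (f : T -> R) (B H : nat -> R) (N1 : nat) (l : R) :
  (forall n, (0 < n)%N -> uniform_upto (P n) N n) ->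
  (forall k, 0 <= B k) -> measurable_fun setT f ->
  (forall w, `|f w| <= B (N w)) -> (forall w, (N1 <= N w)%N -> f w = H (N w)) ->
  has_mean H l ->
  exists2 r : nat -> R, r @ \oo --> l &
    forall n, (0 < n)%N -> f \in Lfun (P n) 1 /\ 'E_(P n)[f]%E = (r n)%:E.
Proof.
move=> unif B0 mf fB fH /has_mean_succ Hl.
have E n : exists r, (0 < n)%N -> [/\ f \in Lfun (P n) 1, 'E_(P n)[f]%E = r%:E &
    `|n%:R * r - \sum_(k < n) H k.+1| <= \sum_(k < N1) (B k + `|H k|)].
  (* The law for [n = 0] is unconstrained, so [r] gets the default value 0 there. *)
  have [->|n0] := posnP n; first by exists 0.
  have [Lf [r [Er rC]]] := uniform_expectation B0 mf fB fH n0 (unif n n0).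
  by exists r.
have /choice[r rP] := E; exists r; last by move=> n n0; have [] := rP n n0.
set C := \sum_(k < N1) _ in rP.
have {}Hl : (\sum_(k < n) H k.+1) / n%:R @[n --> \oo] --> l := Hl.
have <- : l + 0 = l by rewrite addr0.
have -> : r = (fun n => (\sum_(k < n) H k.+1) / n%:R +
                        (r n - (\sum_(k < n) H k.+1) / n%:R)).
  by apply/funext => n; rewrite addrCA subrr addr0.
apply: cvgD => //; apply/cvgr0Pnorm_le => e e0; near=> n.
have n0 : (0 < n)%N by near: n; exact: nbhs_infty_gt.
have n0R : (0 : R) < n%:R by rewrite ltr0n.
have [_ _ rC] := rP n n0.
rewrite -(ler_pM2l n0R) -[X in X * _](gtr0_norm n0R) -normrM mulrBr.
rewrite [_ * (_ / _)]mulrCA divff ?lt0r_neq0// mulr1; apply: le_trans rC _.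
by rewrite -ler_pdivrMr//; near: n; exact: nbhs_infty_ger.
Unshelve. all: end_near. Qed.

Unset Implicit Arguments.
Set Strict Implicit.

(* P n is the law of the experiment for N_0 = n.  Only the law of the house
   size N is prescribed; the resolution of ties is left to an arbitrary random
   choice among the admissible outcomes. *)
Theorem corollary3p8 (R : realType) (m : nat) (p : 'I_m -> R) (beta : R)
    (d : measure_display) (T : measurableType d) (P : nat -> probability T R)
    (N : {mfun T >-> nat}) (s : 'I_m -> {mfun T >-> nat})
    (m_ge2 : (2 <= m)%N)
    (p_gt0 : forall i, 0 < p i)
    (p_sum : \sum_(i < m) p i = 1)
    (p_indep : rat_lin_indep p)
    (N_unif : forall n, (0 < n)%N -> uniform_upto (P n) N n)
    (s_method : forall w, linear_divisor_seats p beta (N w) (fun i => s i w)) :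
  (forall i : 'I_m,
     'V_(P n)[seat_excess p N (fun j => s j : T -> nat) i] @[n --> \oo]
       --> ((1 + (m%:R - 2) * p i ^+ 2) / 12)%:E) /\
  (forall i j : 'I_m, i != j ->
     covariance (P n) (seat_excess p N (fun j => s j : T -> nat) i)
                (seat_excess p N (fun j => s j : T -> nat) j) @[n --> \oo]
       --> (((m%:R - 2) * p i * p j - p i - p j) / 12)%:E).
Proof.
set X := seat_excess p N _.
have m0 : (0 < m)%N by exact: leq_trans m_ge2.
(* Every positive house size has positive probability under some [P n], hence occurs at a sample
   point; the seats at that point define the deterministic sequence [S]. *)
have /choice[om omP] : forall k, exists w, N w = k.+1.
  move=> k; apply: contrapT => /forallNP nw.
  have := N_unif k.+1 isT k.+1; rewrite leqnn => /(_ isT).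
  have -> : [set w | N w = k.+1] = set0 by apply/seteqP; split => // w /= /nw.
  by rewrite measure0 => /eqP; rewrite eqe eq_sym invr_eq0 pnatr_eq0.
pose S k i := s i (om k.-1).
have SP k : (0 < k)%N -> linear_divisor_seats p beta k (S k).
  by case: k => // k _; rewrite -{1}(omP k); exact: s_method.
have [N1 uniq] := seats_unique beta p_gt0 p_sum p_indep.
have XS i w : (maxn 1 N1 <= N w)%N -> X i w = (S (N w) i)%:R - (N w)%:R * p i.
  rewrite geq_max => /andP[w0 wN1]; congr (_%:R - _).
  exact: (uniq _ _ _ wN1 (s_method w) (SP _ w0)).
have [mu [mean1 mean2]] := excess_means p_gt0 p_sum p_indep m0 SP.
have mnat (g : {mfun T >-> nat}) : measurable_fun setT (fun w => (g w)%:R : R).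
  apply: (measurableT_comp (f := fun k : nat => k%:R : R) (g := g)) => //.
have mX i : measurable_fun setT (X i).
  by apply: measurable_funB => //; apply: measurable_funM.
(* A bound growing with the house size is enough, as it enters the error only below a fixed
   threshold. *)
have XB i w : `|X i w| <= (N w)%:R.
  have [sN _] := s_method w.
  have siN : (s i w)%:R <= (N w)%:R :> R.
    by rewrite ler_nat -sN (bigD1 i)//= leq_addr.
  have pi1 : p i <= 1 by rewrite -p_sum (bigD1 i)//= lerDl sumr_ge0// => k _; exact: ltW.
  have := p_gt0 i; have : 0 <= (s i w)%:R :> R by [].
  have : 0 <= (N w)%:R :> R by [].
  rewrite /X /seat_excess ler_norml => H1 H2 H3; apply/andP; split; nra.
have XXB i k w : `|X i w * X k w| <= (N w)%:R ^+ 2.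
  by rewrite normrM expr2 ler_pM.
have XXS i k w : (maxn 1 N1 <= N w)%N -> X i w * X k w =
    ((S (N w) i)%:R - (N w)%:R * p i) * ((S (N w) k)%:R - (N w)%:R * p k).
  by move=> wN; rewrite !XS.
have cov i k : covariance (P n) (X i) (X k) @[n --> \oo] -->
    (((m%:R - 2) * p i * p k - p i - p k + (i == k)%:R * (1 + 2 * p i)) / 12)%:E.
  have [r1 r1l r1P] := uniform_expectation_cvg N_unif (fun k => ler0n _ k) (mX i)
    (XB i) (XS i) (mean1 i).
  have [r2 r2l r2P] := uniform_expectation_cvg N_unif (fun k => ler0n _ k) (mX k)
    (XB k) (XS k) (mean1 k).
  have [r3 r3l r3P] := uniform_expectation_cvg N_unif (fun k => exprn_ge0 2 (ler0n _ k))
    (measurable_funM (mX i) (mX k)) (XXB i k) (XXS i k) (mean2 i k).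
  set L := (X in X%:E).
  have -> : L = mu i * mu k + L - mu i * mu k by rewrite addrC addKr.
  have H : (r3 n - r1 n * r2 n)%:E @[n --> \oo] --> (mu i * mu k + L - mu i * mu k)%:E.
    by apply: cvg_EFin; [exact: nearW|apply: cvgB => //; exact: cvgM].
  apply: cvg_trans H; apply: near_eq_cvg; near=> n.
  have n0 : (0 < n)%N by near: n; exact: nbhs_infty_gt.
  have [L1 E1] := r1P n n0; have [L2 E2] := r2P n n0; have [L3 E3] := r3P n n0.
  by rewrite covarianceE// E1 E2 E3 -EFinM -EFinB.
split=> [i|i j ij].
  have := cov i i; rewrite eqxx mul1r /variance.
  by congr (_ --> _%:E); field.
by have := cov i j; rewrite (negbTE ij) mul0r addr0.
Unshelve. all: end_near. Qed.
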